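(* When $n\ge3$, there exist Möbius transformations $\Phi$ of $\mathbb{S}^{2n-1}$ that strictly decrease the total mean curvature of the Clifford $n$-torus in $\mathbb{R}^{2n}$; that is, such that $$\int_{\Phi(\mathcal{T}^n)}|H|^n\,\mathrm{d}V<\int_{\mathcal{T}^n}|H|^n\,\mathrm{d}V .$$
   Context: The Clifford $n$-torus is $\mathcal{T}^n=\mathbb{S}^1(\sqrt{1/n})\times\cdots\times\mathbb{S}^1(\sqrt{1/n})\subset\mathbb{S}^{2n-1}\subset\mathbb{R}^{2n}$ ($n$ factors). Möbius transformations of $\mathbb{S}^{2n-1}$ are the conformal diffeomorphisms of the round unit sphere. For an $n$-dimensional submanifold of $\mathbb{R}^{2n}$, $H=\frac1n\operatorname{tr}(\text{second fundamental form})$ denotes its mean curvature vector in $\mathbb{R}^{2n}$ and $\mathrm{d}V$ its induced volume element; $\int|H|^n\,\mathrm{d}V$ is the total mean curvature. *)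

(* Defs.v *)
From HB Require Import structures.
From mathcomp Require Import all_boot all_order all_algebra.
From mathcomp Require Import all_classical all_reals all_analysis.
From mathcomp Require Import lra.

Set Implicit Arguments.
Unset Strict Implicit.
Unset Printing Implicit Defensive.

Import Order.TTheory GRing.Theory Num.Theory numFieldNormedType.Exports.
Local Open Scope classical_set_scope.
Local Open Scope ring_scope.

(* The library norm on ['rV[R]_m] is the sup norm: it is used here only through
   its topology. Metric notions go through the Euclidean inner product below. *)
Section Euclidean.
Context {R : realType} {m : nat}.
Implicit Types u v w x : 'rV[R]_m.

Definition dot u v : R := \sum_(j < m) u 0 j * v 0 j.

Definition enorm u : R := Num.sqrt (dot u u).

Definition unit_sphere : set 'rV[R]_m := [set x | dot x x = 1].

End Euclidean.

(* [C^oo] on the open set [U]: every iterated directional derivative of [f] is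
   (Frechet) differentiable, hence continuous, on [U]. *)
Definition smooth_on {R : realType} {V W : normedModType R}
    (U : set V) (f : V -> W) : Prop :=
  forall (vs : seq V) (x : V), U x ->
    differentiable (foldr (fun v (g : V -> W) => 'D_v g) f vs) x.

Section Moebius.
Context {R : realType} {m : nat}.
Implicit Types F G Phi Psi : 'rV[R]_m -> 'rV[R]_m.

Definition smooth_near_sphere G : Prop :=
  exists U : set 'rV[R]_m,
    [/\ open U, unit_sphere `<=` U & smooth_on U G].

(* The tangent space of the sphere at [x] is the orthogonal complement of [x];
   on it, ['d G x] depends only on the restriction of [G] to the sphere. *)
Definition conformal_on_sphere G : Prop :=
  exists lambda : 'rV[R]_m -> R, forall x, unit_sphere x ->
    0 < lambda x /\
    forall v w : 'rV[R]_m, dot x v = 0 -> dot x w = 0 ->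
      dot ('d G x v) ('d G x w) = lambda x ^+ 2 * dot v w.

(* Conformal diffeomorphisms of the round unit sphere of [R^m]. Only the values
   of [Phi] on the sphere matter: a map defined on the sphere is smooth iff it
   extends to a smooth map on a neighbourhood of the sphere, and [G], [Psi] are
   such extensions of [Phi] and of its inverse. *)
Definition is_moebius Phi : Prop :=
  [/\ set_bij unit_sphere unit_sphere Phi,
      exists G, [/\ smooth_near_sphere G,
                    forall x, unit_sphere x -> G x = Phi x
                  & conformal_on_sphere G]
    & exists Psi, smooth_near_sphere Psi /\
                  forall x, unit_sphere x -> Psi (Phi x) = x].

End Moebius.

(* Extrinsic geometry of an immersion [F : R^n -> R^m]. Vectors are rows, so
   row [i] of ['J F t] is the [i]-th partial derivative of [F] at [t]. *)
Section Immersion.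
Context {R : realType} {n m : nat}.
Variable F : 'rV[R]_n -> 'rV[R]_m.
Implicit Types (t : 'rV[R]_n) (w : 'rV[R]_m).

Definition partial2 (i j : 'I_n) t : 'rV[R]_m :=
  'D_(delta_mx 0 i) ('D_(delta_mx 0 j) F) t.

Definition first_fundamental_form t : 'M[R]_n := 'J F t *m ('J F t)^T.

(* [w] minus its orthogonal projection on the tangent space, i.e. on the row
   space of ['J F t]. *)
Definition normal_part t w : 'rV[R]_m :=
  w - w *m ('J F t)^T *m invmx (first_fundamental_form t) *m 'J F t.

Definition second_fundamental_form (i j : 'I_n) t : 'rV[R]_m :=
  normal_part t (partial2 i j t).

Definition mean_curvature t : 'rV[R]_m :=
  n%:R^-1 *: \sum_(i < n) \sum_(j < n)
    invmx (first_fundamental_form t) i j *: second_fundamental_form i j t.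

Definition volume_density t : R := Num.sqrt (\det (first_fundamental_form t)).

End Immersion.

(* Integral over the cube [D ^ n], as an iterated Lebesgue integral; by Tonelli's
   theorem this is the integral against Lebesgue measure on [R^n] for
   nonnegative measurable [f]. *)
Fixpoint cube_integral {R : realType} (D : set R) (n : nat) :
    ('rV[R]_n -> \bar R) -> \bar R :=
  match n with
  | 0%N => fun f => f 0
  | p.+1 => fun f =>
      (\int[lebesgue_measure]_(s in D)
         cube_integral D (fun t : 'rV[R]_p => f (row_mx (const_mx s : 'rV_1) t)))%E
  end.

Definition cube {R : realType} (D : set R) (n : nat) : set 'rV[R]_n :=
  [set t | forall i, D (t 0 i)].

Definition angles {R : realType} : set R := `[0, 2 * pi[.

(* Integral of [|H|^n dV] over the image of [cube angles n] by [F], for an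
   immersion [F] that is injective on this cube. By [clifford_param_bij] and
   [moebius_clifford_param_bij] below, [clifford_param n] and its composite with
   a Moebius map [Phi] parametrize in this way the Clifford torus and its image
   by [Phi]. *)
Definition total_mean_curvature {R : realType} (n m : nat)
    (F : 'rV[R]_n -> 'rV[R]_m) : \bar R :=
  cube_integral angles
    (fun t : 'rV[R]_n => (enorm (mean_curvature F t) ^+ n * volume_density F t)%:E).

(* [R^(2n)] is read as [(R^2)^n]: [vec_mx x i 0] and [vec_mx x i 1] are the
   coordinates of [x] in the [i]-th plane. *)
Definition clifford_torus {R : realType} (n : nat) : set 'rV[R]_(n * 2) :=
  [set x | forall i : 'I_n, vec_mx x i 0 ^+ 2 + vec_mx x i 1 ^+ 2 = n%:R^-1].

Definition clifford_param {R : realType} (n : nat) (t : 'rV[R]_n) :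
    'rV[R]_(n * 2) :=
  mxvec (\matrix_(i < n, j < 2)
    (Num.sqrt n%:R^-1 * (if j == 0 then cos (t 0 i) else sin (t 0 i)))).

Arguments cube {R} D n _.
Arguments clifford_torus {R} n.
Arguments clifford_param {R} n t.

Section CliffordFacts.
Context {R : realType}.

Lemma circle_param (x y : R) : x ^+ 2 + y ^+ 2 = 1 ->
  exists t, [/\ angles t, cos t = x & sin t = y].
Proof.
move=> xy1.
have y2 : y ^+ 2 = 1 - x ^+ 2 by rewrite -xy1 addrC addKr.
have x11 : -1 <= x <= 1.
  by rewrite -ler_norml -(@ler_pXn2r _ 2)// ?nnegrE// expr1n real_normK
    ?num_real// -subr_ge0 -y2 sqr_ge0.
have xI : x \in `[(-1), 1] by rewrite in_itv.
have a0 := acos_ge0 x11; have ap := acos_lepi x11.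
have p0 := pi_gt0 R.
case: (leP 0 y) => [y0|y0].
  exists (acos x); split; last 2 first.
  - exact: acosK.
  - by rewrite sin_acos// -y2 sqrtr_sqr ger0_norm.
  - rewrite /angles /= in_itv /= a0 /= (le_lt_trans ap)// mulr_natl mulr2n.
    by rewrite ltrDl.
have an : 0 < acos x.
  rewrite lt_neqAle a0 andbT; apply/eqP => a00.
  have := sin_acos x11; rewrite -a00 sin0 -y2 sqrtr_sqr => /esym/eqP.
  by rewrite normr_eq0 => /eqP yE; rewrite yE ltxx in y0.
have twopi : 2 * pi = pi *+ 2 :> R by rewrite mulr_natl.
exists (2 * pi - acos x); split.
- rewrite /angles /= in_itv /= gtrBl an andbT subr_ge0 (le_trans ap)//.
  by rewrite twopi mulr2n lerDl ltW.
- by rewrite twopi addrC cosD2pi cosN acosK.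
- rewrite twopi addrC sinD2pi sinN sin_acos// -y2 sqrtr_sqr.
  by rewrite ltr0_norm// opprK.
Qed.

Lemma circle_param_inj (s t : R) : angles s -> angles t ->
  cos s = cos t -> sin s = sin t -> s = t.
Proof.
wlog ts : s t / t <= s.
  move=> W sA tA c sn; have [/W|/ltW/W] := leP t s; first exact.
  by move=> ->.
rewrite /angles /= !in_itv /= => /andP[s0 sp] /andP[t0 tp] ec es.
have cd : cos (s - t) = 1 by rewrite cosB ec es -!expr2 cos2Dsin2.
set h := (s - t) / 2.
have hE : s - t = h *+ 2 by rewrite -mulr_natr divfK.
have sh : sin h = 0.
  move: cd; rewrite hE cos_mulr2n cos2sin2 mulrnBl -addrA addrC -addrA.
  rewrite -[X in _ = X]add0r => /eqP; rewrite mulr2n.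
  rewrite addrA addrA => /eqP H.
  apply/eqP; rewrite -sqrf_eq0; apply/eqP.
  by lra.
apply/eqP; rewrite eq_le ts andbT leNgt; apply/negP => st.
have : 0 < sin h.
  apply: sin_gt0_pi; rewrite /h divr_gt0 ?subr_gt0//=.
  by rewrite ltr_pdivrMr// mulrC; lra.
by rewrite sh ltxx.
Qed.

Lemma clifford_param_bij n : (0 < n)%N ->
  set_bij (cube angles n) (@clifford_torus R n) (clifford_param n).
Proof.
move=> n0; have nR : 0 < n%:R^-1 :> R by rewrite invr_gt0 ltr0n.
have r0 : Num.sqrt n%:R^-1 != 0 :> R by rewrite gt_eqF// sqrtr_gt0.
have r2 : Num.sqrt n%:R^-1 ^+ 2 = n%:R^-1 :> R by rewrite sqr_sqrtr// ltW.
split.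
- move=> t tA i; rewrite /clifford_param mxvecK !mxE /=.
  by rewrite !exprMn r2 -mulrDr cos2Dsin2 mulr1.
- move=> s t /set_mem sA /set_mem tA.
  move=> /(can_inj mxvecK)/matrixP st; apply/rowP => i.
  have := st i 0; have := st i 1; rewrite !mxE /=.
  by move=> /(mulfI r0) sn /(mulfI r0) cs; apply: circle_param_inj.
- move=> x xT.
  pose u i j := vec_mx x i j / Num.sqrt n%:R^-1.
  have /choice[t tP] : forall i : 'I_n,
      exists t : R, [/\ angles t, cos t = u i 0 & sin t = u i 1].
    move=> i; apply: circle_param; rewrite /u !expr_div_n r2 -mulrDl xT.
    by rewrite divff// gt_eqF.
  exists (\row_i t i); first by move=> i; rewrite mxE; case: (tP i).
  rewrite -[RHS]vec_mxK /clifford_param; congr mxvec.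
  apply/matrixP => i j; rewrite [LHS]mxE [X in cos X]mxE [X in sin X]mxE; case: (tP i) => _ -> ->.
  case: (eqVneq j 0) => [->|j0]; first by rewrite /u mulrC divfK.
  have -> : j = 1 by case: j j0 => [[|[|]]]// k _; apply/val_inj.
  by rewrite /u mulrC divfK.
Qed.

Lemma clifford_torus_sphere n : (0 < n)%N ->
  @clifford_torus R n `<=` @unit_sphere R (n * 2).
Proof.
move=> n0 x xT; rewrite /unit_sphere /= /dot.
under eq_bigr do rewrite -expr2.
rewrite (reindex _ (curry_mxvec_bij n 2)) /=.
rewrite (eq_bigr (fun p => x 0 (mxvec_index p.1 p.2) ^+ 2)); last by case.
rewrite -(pair_bigA _ (fun i j => x 0 (mxvec_index i j) ^+ 2)) /=.
rewrite (eq_bigr (fun=> n%:R^-1)) => [|i _].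
  by rewrite sumr_const card_ord -[LHS]mulr_natr mulVf// pnatr_eq0 -lt0n.
rewrite -(xT i) big_ord_recl big_ord1 !mxE; congr (_ + x 0 (mxvec_index _ _) ^+ 2).
exact/val_inj.
Qed.

Lemma moebius_clifford_param_bij n (Phi : 'rV[R]_(n * 2) -> 'rV[R]_(n * 2)) :
  (0 < n)%N -> is_moebius Phi ->
  set_bij (cube angles n) (Phi @` clifford_torus n) (Phi \o clifford_param n).
Proof.
move=> n0 [[_ Phi_inj _] _ _].
apply: set_bij_comp (clifford_param_bij n0) _; apply: inj_bij.
move=> x y /set_mem xT /set_mem yT; apply: Phi_inj; apply/mem_set;
  exact: clifford_torus_sphere.
Qed.

End CliffordFacts.

(* Main.v *)
Require Import Defs.
From mathcomp Require Import all_boot all_order all_algebra.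
From mathcomp Require Import all_classical all_reals all_analysis.
From mathcomp Require Import measurable_realfun ring lra.

Import Order.TTheory GRing.Theory Num.Theory numFieldNormedType.Exports.
Local Open Scope classical_set_scope.
Local Open Scope ring_scope.

(** The transformations used are the translations of the hyperbolic ball,
      Phi_p (x) = - p + (1 - |p|^2) (x - p) / D,  D = 1 + |p|^2 - 2 <x, p>,
    for |p| < 1, which are conformal diffeomorphisms of the unit sphere with
    inverse Phi_(-p) ([is_moebius_ball_translation]).

    The Clifford torus is minimal in the sphere, so |H| = 1 on it. The
    translated parametrization is conformal to the flat one, and computing its
    second derivatives ([translated_mean_curvature_sq]) gives, up to the constant
    n^(-n/2),
      |H|^n dV = (1 + 4 <x, p> / D - 4 |p_T|^2 / D^2)^(n/2),
    where p_T is the tangential part of p at the point x of the torus. Write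
    p = - |p| e and r = 2 |p| / (1 + |p|^2); with l = <x, e> and
    q = l^2 + |e_T|^2 this is
      (sqrt (1 - r^2 q) / (1 + r l))^n.

    It remains to expand in powers of r and to average over the angles. Odd
    orders vanish because x -> - x preserves the torus. Order 2 vanishes too: it
    is proportional to n E l^2 - E |e_T|^2, which is 0 because the coordinates
    are eigenfunctions of the Laplacian of the torus for the eigenvalue n. So the
    sign is decided at order 4, and it depends on the direction: if e has a
    component a_i along the first axis of the i-th plane and no other component,
    the coefficient is (n - 2) ((n + 1) sum a_i^4 - 2) / 32. It is positive if
    n >= 3 and e lies in a single plane, but for a_i = 1 / sqrt n it is
    - (n - 1) (n - 2) / (32 n), negative as soon as n >= 3
    ([translated_total_le]). A small r > 0 then decreases the total mean
    curvature.

    For this direction l and q are polynomials in S, the sum of the cosines of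
    the angles, and P, the sum of their squares. The integrand is bounded above
    by its Taylor polynomial of order 4 plus C r^5, uniformly in the angles
    ([integrand_taylor4]), and the integral of such a polynomial over the cube
    of angles is computed one angle at a time ([cube_integral_quartic]). *)

Set Implicit Arguments.
Unset Strict Implicit.
Unset Printing Implicit Defensive.

(** * Integrals over the cube of angles *)

(** The integral of a nonnegative function is a supremum over the simple
    functions below it, hence monotone for arbitrary integrands, here the
    curvature density against a trigonometric polynomial. *)
Lemma ge0_le_integral_sup d (T : measurableType d) (R : realType)
    (mu : {measure set T -> \bar R}) (D : set T) (f g : T -> \bar R) :
  (forall x, D x -> (0 <= f x)%E) -> (forall x, D x -> (f x <= g x)%E) ->
  (\int[mu]_(x in D) f x <= \int[mu]_(x in D) g x)%E.
Proof.
move=> f0 fg; rewrite !ge0_integralE//; last first.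
  by move=> x Dx; apply: le_trans (f0 _ Dx) (fg _ Dx).
apply: ereal_sup_le => _ [h /= hf <-].
exists h => //= x; apply: le_trans (hf x) _.
by rewrite /patch; case: ifP => // /set_mem /fg.
Qed.

Lemma cube_integral_ge0 (R : realType) (D : set R) n (f : 'rV[R]_n -> \bar R) :
  (forall t, (0 <= f t)%E) -> (0 <= cube_integral D f)%E.
Proof.
elim: n f => [|n IH] f f0 /=; first exact: f0.
by apply: integral_ge0 => s _; apply: IH.
Qed.

Lemma le_cube_integral (R : realType) (D : set R) n
    (f g : 'rV[R]_n -> \bar R) :
  (forall t, (0 <= f t)%E) -> (forall t, (f t <= g t)%E) ->
  (cube_integral D f <= cube_integral D g)%E.
Proof.
elim: n f g => [|n IH] f g f0 fg /=; first exact: fg.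
apply: ge0_le_integral_sup => s _; last exact: IH.
exact: cube_integral_ge0.
Qed.

Section CosineMoments.
Context {R : realType}.

Lemma integral_cos_quartic (a0 a1 a2 a3 a4 : R) :
  (\int[lebesgue_measure]_(s in angles)
     (a0 + a1 * cos s + a2 * cos s ^+ 2 + a3 * cos s ^+ 3 + a4 * cos s ^+ 4)%:E
   = (2 * pi * (a0 + a2 / 2 + a4 * (3 / 8)))%:E)%E.
Proof.
pose f (s : R) :=
  a0 + a1 * cos s + a2 * cos s ^+ 2 + a3 * cos s ^+ 3 + a4 * cos s ^+ 4.
(* Antiderivative obtained from cos^2 = (1 + cos 2s) / 2 and two integrations by
   parts for cos^3 and cos^4. *)
pose F (s : R) := a0 * s + a1 * sin s + a2 / 2 * (s + sin s * cos s) +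
  a3 * (sin s - 3^-1 * sin s ^+ 3) +
  a4 * (3 / 8 * (s + sin s * cos s) + 4^-1 * (sin s * cos s ^+ 3)).
have dF (s : R) : is_derive s (1 : R) F (f s).
  rewrite /F; apply: is_derive_eq.
  rewrite /GRing.scale /= /f.
  have E : sin s ^+ 2 = 1 - cos s ^+ 2 by rewrite -(cos2Dsin2 s); ring.
  by field: E; rewrite ?pnatr_eq0.
have p0 : 0 < 2 * pi :> R by rewrite mulr_gt0// pi_gt0.
have cf : continuous f.
  move=> s; rewrite /f; apply/differentiable_continuous/derivable1_diffP.
  exact: ex_derive.
have cF : continuous F.
  move=> s; apply/differentiable_continuous/derivable1_diffP.
  exact: ex_derive.
rewrite /angles integral_itv_bndo_bndc; last first.
  apply/measurable_EFinP; apply: measurable_funTS.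
  exact: continuous_measurable_fun.
rewrite (@continuous_FTC2 _ f F)//.
- rewrite -EFinB /F; congr EFin.
  have -> : 2 * pi = pi *+ 2 :> R by rewrite mulr_natl.
  by rewrite sin2pi sin0 -mulr_natr; field.
- exact: continuous_subspaceT.
- split.
  + by move=> s _; exact: ex_derive.
  + by apply: cvg_at_right_filter; exact: cF.
  + by apply: cvg_at_left_filter; exact: cF.
- by move=> s _; rewrite derive1E; exact: derive_val.
Qed.

Definition cos_sum n (t : 'rV[R]_n) : R := \sum_(i < n) cos (t 0 i).
Definition cos2_sum n (t : 'rV[R]_n) : R := \sum_(i < n) cos (t 0 i) ^+ 2.

Lemma sum_row_mx (g : R -> R) n s (t : 'rV[R]_n) :
  \sum_(i < n.+1) g ((row_mx (const_mx s : 'rV_1) t : 'rV_(1 + n)) 0 i) =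
  g s + \sum_(i < n) g (t 0 i).
Proof.
rewrite (@big_split_ord _ _ _ 1 n) /= big_ord1 row_mxEl mxE; congr (_ + _).
by apply: eq_bigr => i _; rewrite row_mxEr.
Qed.

(** Averages over the angles: the polynomials in [S] (weight 1) and [P]
    (weight 2) of weight at most 4 form a space that is stable under the
    substitution [S := cos s + S], [P := cos s ^+ 2 + P], so integrating out one
    angle at a time never leaves it. With independent uniform angles the values
    are E S^2 = E P = n/2, E S^4 = 3n^2/4 - 3n/8 and
    E S^2 P = E P^2 = n^2/4 + n/8, and the odd moments vanish. *)
Lemma cube_integral_quartic n (c0 c1 c2 c3 c4 d0 d1 d2 e : R) :
  cube_integral angles (fun t : 'rV[R]_n =>
    let S := cos_sum t in let P := cos2_sum t in
    (c0 + c1 * S + c2 * S ^+ 2 + c3 * S ^+ 3 + c4 * S ^+ 4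
     + d0 * P + d1 * (S * P) + d2 * (S ^+ 2 * P) + e * P ^+ 2)%:E)
  = ((2 * pi) ^+ n * (c0 + c2 * (n%:R / 2)
      + c4 * (3 / 4 * n%:R ^+ 2 - 3 / 8 * n%:R) + d0 * (n%:R / 2)
      + (d2 + e) * (n%:R ^+ 2 / 4 + n%:R / 8)))%:E.
Proof.
elim: n c0 c1 c2 c3 c4 d0 d1 d2 e => [|n IH] c0 c1 c2 c3 c4 d0 d1 d2 e.
  by rewrite /= /cos_sum /cos2_sum !big_ord0; congr EFin; ring.
(* Coefficients, as a polynomial in the cosine of the first angle, of the mean
   over the remaining n angles. *)
pose c0' : R := c0 + (c2 * (n%:R / 2)
      + c4 * (3 / 4 * n%:R ^+ 2 - 3 / 8 * n%:R) + d0 * (n%:R / 2)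
      + (d2 + e) * (n%:R ^+ 2 / 4 + n%:R / 8)).
pose c1' : R := c1 + 3 * c3 * (n%:R / 2) + d1 * (n%:R / 2).
pose c2' : R := c2 + d0 + (6 * c4 + d2) * (n%:R / 2)
  + (d2 + 2 * e) * (n%:R / 2).
pose c3' : R := c3 + d1.
pose c4' : R := c4 + d2 + e.
rewrite [LHS]/=.
transitivity (\int[lebesgue_measure]_(s in angles) (
    (2 * pi) ^+ n * c0' + (2 * pi) ^+ n * c1' * cos s
    + (2 * pi) ^+ n * c2' * cos s ^+ 2 + (2 * pi) ^+ n * c3' * cos s ^+ 3
    + (2 * pi) ^+ n * c4' * cos s ^+ 4)%:E)%E.
  apply: eq_integral => s _; set c := cos s.
  rewrite (_ : (fun t => _) = (fun t : 'rV[R]_n =>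
    let S := cos_sum t in let P := cos2_sum t in
    ((c0 + c1 * c + (c2 + d0) * c ^+ 2 + (c3 + d1) * c ^+ 3
      + (c4 + d2 + e) * c ^+ 4)
     + (c1 + 2 * c2 * c + (3 * c3 + d1) * c ^+ 2
        + (4 * c4 + 2 * d2) * c ^+ 3) * S
     + (c2 + 3 * c3 * c + (6 * c4 + d2) * c ^+ 2) * S ^+ 2
     + (c3 + 4 * c4 * c) * S ^+ 3 + c4 * S ^+ 4
     + (d0 + d1 * c + (d2 + 2 * e) * c ^+ 2) * P
     + (d1 + 2 * d2 * c) * (S * P) + d2 * (S ^+ 2 * P) + e * P ^+ 2)%:E)).
    by rewrite IH; congr EFin; rewrite /c1' /c0' /c2' /c3' /c4'; field.
  apply/funext => t /=; congr EFin.
  have -> : cos_sum (row_mx (const_mx s : 'rV_1) t : 'rV_(n.+1)) =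
      c + cos_sum t by exact: (sum_row_mx (@cos R)).
  have -> : cos2_sum (row_mx (const_mx s : 'rV_1) t : 'rV_(n.+1)) =
      c ^+ 2 + cos2_sum t by exact: (sum_row_mx (fun x => cos x ^+ 2)).
  ring.
rewrite integral_cos_quartic; congr EFin.
by rewrite exprS -[n.+1%:R]natr1 /c0' /c2' /c4'; field.
Qed.
End CosineMoments.

(** * Fourth order expansion of the integrand *)

Section Taylor.
Context {R : realType}.

(** Pascal's rule makes (1 + x) T(n+1) equal to T(n) + t x^5, where T(n) is the
    Taylor polynomial of (1 + x)^-n and t the leading coefficient of T(n+1); the
    error bound thus passes from n to n + 1. *)
Lemma expfV_taylor4 n : exists C : R, forall x, `|x| <= 1 / 2 ->
  `| (1 + x) ^- n - (1 - n%:R * x + n%:R * (n%:R + 1) / 2 * x ^+ 2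
      - n%:R * (n%:R + 1) * (n%:R + 2) / 6 * x ^+ 3
      + n%:R * (n%:R + 1) * (n%:R + 2) * (n%:R + 3) / 24 * x ^+ 4) |
  <= C * `|x| ^+ 5.
Proof.
elim: n => [|n [C IH]].
  exists 0 => x _; rewrite expr0 invr1 mul0r.
  by rewrite (_ : _ - _ = 0) ?normr0//; ring.
pose t : R := (n%:R + 1) * (n%:R + 2) * (n%:R + 3) * (n%:R + 4) / 24.
exists (2 * (C + `|t|)) => x x2.
have x1 : 1 / 2 <= 1 + x by move: x2; rewrite ler_norml => /andP[]; lra.
have x0 : 0 < 1 + x by lra.
rewrite -natr1; set E := (X in `|X| <= _).
have EE : (1 + x) * E = (1 + x) ^- n - (1 - n%:R * x
      + n%:R * (n%:R + 1) / 2 * x ^+ 2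
      - n%:R * (n%:R + 1) * (n%:R + 2) / 6 * x ^+ 3
      + n%:R * (n%:R + 1) * (n%:R + 2) * (n%:R + 3) / 24 * x ^+ 4)
      - t * x ^+ 5.
  rewrite /E mulrBr exprS invfM mulrA mulfV ?gt_eqF// mul1r.
  by rewrite /t; move: ((1 + x) ^- n) => w; field.
have H : `|(1 + x) * E| <= (C + `|t|) * `|x| ^+ 5.
  rewrite EE (le_trans (ler_normB _ _))// mulrDl lerD ?IH//.
  by rewrite normrM normrX.
rewrite normrM gtr0_norm// in H.
apply: (@le_trans _ _ (2 * ((1 + x) * `|E|))).
  by have := normr_ge0 E; nra.
by rewrite -mulrA ler_pM2l.
Qed.

(** Multiplying by 1 - y takes the bound for n to the one for n + 2. The cubic
    term that this creates is n (2 - n) / 8 y^3, positive for n = 1, and the error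
    coefficient n / 8 grows fast enough to absorb it. *)
Lemma sqrt1B_expn_le n (y : R) : 0 <= y <= 1 ->
  Num.sqrt (1 - y) ^+ n <=
  1 - n%:R / 2 * y + n%:R * (n%:R - 2) / 8 * y ^+ 2 + n%:R / 8 * y ^+ 3.
Proof.
move=> /andP[y0 y1].
have y3 : 0 <= y ^+ 3 by rewrite exprn_ge0.
have s0 : 0 <= 1 - y by lra.
have sq : Num.sqrt (1 - y) <= 1 - y / 2 - y ^+ 2 / 8.
  have p0 : 0 <= 1 - y / 2 - y ^+ 2 / 8 by nra.
  rewrite -(ger0_norm p0) -sqrtr_sqr ler_sqrt ?sqr_ge0//.
  have y4 := exprn_ge0 4 y0.
  by rewrite -subr_ge0 (_ : _ - _ = y ^+ 3 / 8 + y ^+ 4 / 64); [lra | field].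
(* Two consecutive exponents at a time, as the induction step has length 2. *)
suff : forall m, let B m := Num.sqrt (1 - y) ^+ m <= 1 - m%:R / 2 * y
    + m%:R * (m%:R - 2) / 8 * y ^+ 2 + m%:R / 8 * y ^+ 3 in B m /\ B m.+1.
  by move=> /(_ n)[].
elim=> [|m [B0 B1]] /=.
  rewrite expr0 expr1 !mul0r; split; first by lra.
  by lra.
split=> //; rewrite -addn2 exprD sqr_sqrtr// mulrC.
apply: le_trans (ler_wpM2l s0 B0) _.
rewrite natrD -subr_ge0.
rewrite (_ : _ - _ = y ^+ 3 / 8 * (m%:R * (m%:R - 2) + 2 + m%:R * y)).
  apply: mulr_ge0; first lra.
  have m0 := ler0n R m; have my := mulr_ge0 m0 y0.
  have := sqr_ge0 (m%:R - 1 : R); rewrite expr2; lra.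
by field.
Qed.

(** Upper Taylor expansion, uniform on the range of l and q, of the integrand of
    the translated torus, with r the size of the translation. It is the product
    of the two expansions above at x = r l and y = r^2 q. *)
Lemma integrand_taylor4 n : exists2 C : R, 0 <= C &
  forall r l q, 0 <= r <= 1 / 2 -> `|l| <= 1 -> 0 <= q <= 1 ->
  (Num.sqrt (1 - r ^+ 2 * q) / (1 + r * l)) ^+ n <=
  1 - n%:R * (r * l)
  + (n%:R * (n%:R + 1) / 2 * l ^+ 2 - n%:R / 2 * q) * r ^+ 2
  + (n%:R ^+ 2 / 2 * (l * q)
     - n%:R * (n%:R + 1) * (n%:R + 2) / 6 * l ^+ 3) * r ^+ 3
  + (n%:R * (n%:R + 1) * (n%:R + 2) * (n%:R + 3) / 24 * l ^+ 4
     - n%:R ^+ 2 * (n%:R + 1) / 4 * (l ^+ 2 * q)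
     + n%:R * (n%:R - 2) / 8 * q ^+ 2) * r ^+ 4
  + C * r ^+ 5.
Proof.
have [C1 C1P] := expfV_taylor4 n.
have C1_ge0 : 0 <= C1.
  have h2 : `|1 / 2 : R| = 1 / 2 by rewrite ger0_norm//; lra.
  have := C1P (1 / 2); rewrite h2 => /(_ (lexx _)).
  move=> /(le_trans (normr_ge0 _)); rewrite pmulr_lge0// exprn_gt0//; lra.
pose N : R := n%:R.
pose t1 := - N. pose t2 := N * (N + 1) / 2.
pose t3 := - (N * (N + 1) * (N + 2) / 6).
pose t4 := N * (N + 1) * (N + 2) * (N + 3) / 24.
pose u1 := - (N / 2). pose u2 := N * (N - 2) / 8.
pose MT := 1 + `|t1| + `|t2| + `|t3| + `|t4|.
pose MU := 1 + `|u1| + `|u2|.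
pose K := `|t3 * u1| + `|t4 * u1| + `|t1 * u2| + `|t2 * u2| + `|t3 * u2|
  + `|t4 * u2|.
have N0 : 0 <= N by exact: ler0n.
exists (K + MU * C1 + N / 8 * MT + N / 8 * C1).
  by rewrite !addr_ge0// !mulr_ge0// ?addr_ge0//; lra.
move=> r l q /andP[r0 r2] l1 /andP[q0 q1].
have r1 : r <= 1 by lra.
have rl : `|r * l| <= 1 / 2.
  by rewrite normrM (ger0_norm r0); have := normr_ge0 l; nra.
have rl5 : `|r * l| ^+ 5 <= r ^+ 5.
  by rewrite lerXn2r ?nnegrE// normrM ger0_norm// ler_piMr.
have rq0 : 0 <= r ^+ 2 * q by rewrite mulr_ge0// exprn_ge0.
have rq1 : r ^+ 2 * q <= 1 by rewrite mulr_ile1// ?exprn_ge0// exprn_ile1.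
have nr i : `|r ^+ i| <= 1 by rewrite normrX exprn_ile1// ger0_norm.
have nl i : `|l ^+ i| <= 1 by rewrite normrX exprn_ile1.
have nq i : `|q ^+ i| <= 1 by rewrite normrX exprn_ile1// ger0_norm.
have mono c i j k : c * (r ^+ i * l ^+ j * q ^+ k) <= `|c|.
  apply: le_trans (ler_norm _) _; rewrite normrM ler_piMr//.
  by rewrite !normrM !mulr_ile1// mulr_ge0.
have x0 : 0 < 1 + r * l by move: rl; rewrite ler_norml => /andP[]; lra.
rewrite expr_div_n.
pose T := 1 + t1 * (r * l) + t2 * (r * l) ^+ 2 + t3 * (r * l) ^+ 3
  + t4 * (r * l) ^+ 4.
pose U := 1 + u1 * (r ^+ 2 * q) + u2 * (r ^+ 2 * q) ^+ 2.
have r5 : 0 <= r ^+ 5 by rewrite exprn_ge0.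
have HT : (1 + r * l) ^- n <= T + C1 * r ^+ 5.
  have := le_trans (C1P _ rl) (ler_wpM2l C1_ge0 rl5).
  rewrite ler_norml => /andP[_].
  by rewrite lerBlDr => /le_trans; apply; rewrite /T /t1 /t2 /t3 /t4 /N; lra.
have HU : Num.sqrt (1 - r ^+ 2 * q) ^+ n <= U + N / 8 * (r ^+ 2 * q) ^+ 3.
  apply: le_trans (@sqrt1B_expn_le n (r ^+ 2 * q) _) _; first by rewrite rq0.
  by rewrite /U /u1 /u2 /N; lra.
have MTP : T <= MT.
  rewrite /T /MT !lerD//.
  - by have := mono t1 1%N 1%N 0%N; rewrite expr0 mulr1 !expr1.
  - by have := mono t2 2%N 2%N 0%N; rewrite expr0 mulr1 exprMn.
  - by have := mono t3 3%N 3%N 0%N; rewrite expr0 mulr1 exprMn.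
  - by have := mono t4 4%N 4%N 0%N; rewrite expr0 mulr1 exprMn.
have MUP : U <= MU.
  rewrite /U /MU !lerD//.
  - by have := mono u1 2%N 0%N 1%N; rewrite expr0 mulr1 expr1.
  - by have := mono u2 4%N 0%N 2%N; rewrite expr0 mulr1 exprMn -exprM.
have I0 : 0 <= (1 + r * l) ^- n by rewrite invr_ge0 exprn_ge0// ltW.
apply: le_trans (ler_pM (exprn_ge0 n (sqrtr_ge0 _)) I0 HU HT) _.
have M5 : (r ^+ 2 * q) ^+ 3 <= r ^+ 5.
  have -> : (r ^+ 2 * q) ^+ 3 = r ^+ 5 * (r * q ^+ 3) by ring.
  by rewrite ler_piMr// mulr_ile1 ?exprn_ge0// exprn_ile1.
have N8 : 0 <= N / 8 by lra.
have X0 : 0 <= N / 8 * (r ^+ 2 * q) ^+ 3 by rewrite mulr_ge0// exprn_ge0.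
have X5 : N / 8 * (r ^+ 2 * q) ^+ 3 <= N / 8 * r ^+ 5 by rewrite ler_wpM2l.
have MT0 : 0 <= MT by rewrite !addr_ge0.
have B1 : N / 8 * (r ^+ 2 * q) ^+ 3 * T <= N / 8 * MT * r ^+ 5.
  apply: le_trans (ler_wpM2l X0 MTP) _.
  by rewrite [leRHS]mulrAC ler_wpM2r.
have B2 : N / 8 * (r ^+ 2 * q) ^+ 3 * (C1 * r ^+ 5) <= N / 8 * C1 * r ^+ 5.
  rewrite [leRHS]mulrAC ler_pM//; first by rewrite mulr_ge0.
  by rewrite ler_piMr// exprn_ile1.
have B3 : U * (C1 * r ^+ 5) <= MU * C1 * r ^+ 5.
  by rewrite -[leRHS]mulrA ler_wpM2r// mulr_ge0.
(* The terms of order 5 and more in r of the product of the two polynomials,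
   divided by r^5. *)
pose h := t3 * u1 * (r ^+ 0 * l ^+ 3 * q ^+ 1)
  + t4 * u1 * (r ^+ 1 * l ^+ 4 * q ^+ 1)
  + t1 * u2 * (r ^+ 0 * l ^+ 1 * q ^+ 2)
  + t2 * u2 * (r ^+ 1 * l ^+ 2 * q ^+ 2)
  + t3 * u2 * (r ^+ 2 * l ^+ 3 * q ^+ 2)
  + t4 * u2 * (r ^+ 3 * l ^+ 4 * q ^+ 2).
have hK : h <= K by rewrite /h /K !lerD.
have B4 := ler_wpM2r r5 hK.
set Q := (X in _ <= X + _).
have -> : (U + N / 8 * (r ^+ 2 * q) ^+ 3) * (T + C1 * r ^+ 5) =
  Q + h * r ^+ 5 + N / 8 * (r ^+ 2 * q) ^+ 3 * T
  + N / 8 * (r ^+ 2 * q) ^+ 3 * (C1 * r ^+ 5) + U * (C1 * r ^+ 5).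
  by rewrite /Q /h /U /T /u1 /u2 /t1 /t2 /t3 /t4 -/N; field.
lra.
Qed.
End Taylor.

(** * Euclidean product and derivatives of row-valued maps *)

Section Dot.
Context {R : realType} {m : nat}.
Implicit Types u v w : 'rV[R]_m.

Lemma dotC u v : dot u v = dot v u.
Proof. by apply: eq_bigr => j _; rewrite mulrC. Qed.

Lemma dotDl u v w : dot (u + v) w = dot u w + dot v w.
Proof. by rewrite -big_split; apply: eq_bigr => j _; rewrite mxE mulrDl. Qed.

Lemma dotZl a u w : dot (a *: u) w = a * dot u w.
Proof. by rewrite mulr_sumr; apply: eq_bigr => j _; rewrite mxE mulrA. Qed.

Lemma dotDr u v w : dot w (u + v) = dot w u + dot w v.
Proof. by rewrite !(dotC w) dotDl. Qed.

Lemma dotZr a u w : dot w (a *: u) = a * dot w u.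
Proof. by rewrite !(dotC w) dotZl. Qed.

Lemma dotNl u w : dot (- u) w = - dot u w.
Proof. by rewrite -scaleN1r dotZl mulN1r. Qed.

Lemma dotNr u w : dot w (- u) = - dot w u.
Proof. by rewrite !(dotC w) dotNl. Qed.

Lemma dot0l w : dot 0 w = 0.
Proof. by rewrite -(scale0r 0) dotZl mul0r. Qed.

Lemma dot_suml (I : finType) (F : I -> 'rV[R]_m) w :
  dot (\sum_i F i) w = \sum_i dot (F i) w.
Proof.
by apply: (big_morph (dot^~ w)) => [u v|]; [exact: dotDl | exact: dot0l].
Qed.

Lemma dot_sumr (I : finType) (F : I -> 'rV[R]_m) w :
  dot w (\sum_i F i) = \sum_i dot w (F i).
Proof. by rewrite dotC dot_suml; apply: eq_bigr => i _; rewrite dotC. Qed.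

Lemma dot_ge0 u : 0 <= dot u u.
Proof. by apply: sumr_ge0 => j _; rewrite -expr2 sqr_ge0. Qed.

Lemma dot_eq0 u : dot u u = 0 -> u = 0.
Proof.
move=> u0; apply/rowP => j; rewrite mxE; apply/eqP; rewrite -sqrf_eq0 expr2.
apply/eqP; apply: (psumr_eq0P (F := fun j => u 0 j * u 0 j) _ u0) => // i _.
by rewrite -expr2 sqr_ge0.
Qed.

End Dot.

Definition dotE := (@dotDl, @dotDr, @dotZl, @dotZr, @dotNl, @dotNr).

Section RowDerivative.
Context {R : realType} {V : normedModType R} {m : nat}.
Implicit Types (Y : V -> 'rV[R]_m) (s : V -> R) (t v : V).

Lemma is_derive_rowP Y t v dY :
  is_derive t v Y dY <-> forall j, is_derive t v (fun t => Y t 0 j) (dY 0 j).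
Proof.
split=> [[dv <-] j|H].
  have dvj := (derivable_mxP _ _ _).1 dv 0 j.
  by split=> //; rewrite derive_mx// mxE.
have dv : derivable Y t v.
  by apply/derivable_mxP => i j; rewrite (ord1 i); have [] := H j.
split=> //; apply/rowP => j; rewrite derive_mx// mxE.
by have [] := H j.
Qed.

Lemma is_derive_inv s t v ds : s t != 0 -> is_derive t v s ds ->
  is_derive t v (fun t => (s t)^-1) (- ds / s t ^+ 2).
Proof.
move=> s0 [dv <-]; split; first exact: derivableV.
by rewrite deriveV// /GRing.scale /= mulrC mulrN mulNr.
Qed.

Lemma is_derive_scale s Y t v ds dY : is_derive t v s ds ->
  is_derive t v Y dY ->
  is_derive t v (fun t => s t *: Y t) (ds *: Y t + s t *: dY).
Proof.
move=> Ds /is_derive_rowP DY; apply/is_derive_rowP => j.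
under eq_fun do rewrite mxE.
have := DY j => DYj; apply: is_derive_eq.
by rewrite !mxE /GRing.scale /=; ring.
Qed.

Lemma is_derive_dot Y t v dY p : is_derive t v Y dY ->
  is_derive t v (fun t => dot (Y t) p) (dot dY p).
Proof.
move=> /is_derive_rowP DY; rewrite /dot.
have -> : (fun t => \sum_(j < m) Y t 0 j * p 0 j) =
    \sum_(j < m) (fun t => Y t 0 j * p 0 j).
  by apply/funext => x; rewrite fct_sumE.
apply: is_derive_sum => j.
have := DY j => DYj; apply: is_derive_eq.
by rewrite scaler0 add0r /GRing.scale /= mulrC.
Qed.

Lemma differentiable_row Y t : (forall j, differentiable (fun t => Y t 0 j) t) ->
  differentiable Y t.
Proof.
move=> H.
have -> : Y = \sum_(j < m) (fun t => Y t 0 j *: delta_mx 0 j).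
  by apply/funext => x; rewrite fct_sumE [LHS]row_sum_delta.
by apply: differentiable_sum => j; apply: differentiableZl.
Qed.

End RowDerivative.

(** Frechet differentiability is a local property: the difference of the two
    maps vanishes near x, so that its differential at x is 0. *)
Lemma near_differentiable (R : realType) (V W : normedModType R)
    (f g : V -> W) x :
  (\near x, f x = g x) -> differentiable f x -> differentiable g x.
Proof.
move=> fg df.
have -> : g = f + (g - f) by rewrite addrC subrK.
apply: differentiableD => //.
set k := g - f.
have k0 : \forall y \near x, k y = 0.
  by near=> y; rewrite /k !fctE (near fg y)// subrr.
have E : k \o shift x = cst (k x) + (\0 : {linear V -> W}) +o_ 0 id.
  apply/eqaddoP => e e0; near=> h.
  rewrite !fctE /=.
  have -> : k (h + x) = 0.
    near: h; have : (h + x) @[h --> (0 : V)] --> x.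
      rewrite -[X in _ --> X]add0r.
      by apply: cvgD; [exact: cvg_id | exact: cvg_cst].
    by move=> /(_ _ k0).
  rewrite (nbhs_singleton k0) addr0 subr0 normr0.
  by rewrite mulr_ge0// ltW.
have c0 : continuous (\0 : {linear V -> W}) by move=> y; exact: cvg_cst.
by apply/diff_locallyP; rewrite (diff_unique c0 E).
Unshelve. all: by end_near. Qed.

(** * Translations of the ball as conformal maps of the sphere *)

Section Moebius.
Context {R : realType} {m : nat}.
Implicit Types p x v w : 'rV[R]_m.

Definition moebius_den p x := 1 + dot p p - 2 * dot x p.

(** A translation of hyperbolic space in the projective model of the ball, which
    takes [p] to [- p]. On the unit sphere the denominator is the squared distance
    from [x] to [p], and there the map is conformal; the affine denominator
    extends it with simple derivatives. *)
Definition ball_translation p x :=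
  - p + ((1 - dot p p) / moebius_den p x) *: (x - p).

Lemma moebius_denE p x : unit_sphere x -> moebius_den p x = dot (x - p) (x - p).
Proof. by move=> x1; rewrite !dotE (dotC p x) x1 /moebius_den; ring. Qed.

Lemma moebius_den_gt0 p x : dot p p < 1 -> unit_sphere x ->
  0 < moebius_den p x.
Proof.
move=> p1 x1; rewrite moebius_denE// lt_neqAle dot_ge0 andbT eq_sym.
apply/eqP => /dot_eq0/subr0_eq xp.
by move: p1; rewrite -xp x1 ltxx.
Qed.

Lemma ball_translation_sphere p x : dot p p < 1 -> unit_sphere x ->
  unit_sphere (ball_translation p x).
Proof.
move=> p1 x1; have := moebius_den_gt0 p1 x1.
rewrite /unit_sphere /= /ball_translation !dotE (dotC p x) x1 /moebius_den.
by move=> /lt0r_neq0 D0; field.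
Qed.

Lemma ball_translationK p x : dot p p < 1 -> unit_sphere x ->
  ball_translation (- p) (ball_translation p x) = x.
Proof.
move=> p1 x1; have D0 := moebius_den_gt0 p1 x1.
have pp : 1 - dot p p != 0 by rewrite subr_eq0 gt_eqF.
have -> : ball_translation (- p) (ball_translation p x) =
  p + ((1 - dot p p) / moebius_den (- p) (ball_translation p x)) *:
      (((1 - dot p p) / moebius_den p x) *: (x - p)).
  rewrite {1}/ball_translation !dotE !opprK; congr (_ + _ *: _).
  by rewrite /ball_translation addrAC addNr add0r.
have -> : moebius_den (- p) (ball_translation p x) =
    (1 - dot p p) ^+ 2 / moebius_den p x.
  move: D0; rewrite /ball_translation /moebius_den !dotE => D0.
  by field; rewrite gt_eqF.
rewrite scalerA; set a := (X in X *: _).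
have -> : a = 1 by rewrite /a; field; rewrite pp gt_eqF.
by rewrite scale1r addrC subrK.
Qed.

(** Smoothness in the sense of iterated directional derivatives needs a class of
    functions that contains the coordinates of [ball_translation p] and is stable
    under differentiation away from the zeros of the denominator. *)
Inductive rational_off p : ('rV[R]_m -> R) -> Prop :=
| rational_cst c : rational_off p (fun=> c)
| rational_coord j : rational_off p (fun x => x 0 j)
| rational_inv : rational_off p (fun x => (moebius_den p x)^-1)
| rational_add f g : rational_off p f -> rational_off p g ->
    rational_off p (fun x => f x + g x)
| rational_mul f g : rational_off p f -> rational_off p g ->
    rational_off p (fun x => f x * g x).

Lemma differentiable_moebius_den p x : differentiable (moebius_den p) x.
Proof.
have -> : moebius_den p = cst (1 + dot p p) -
    2 *: \sum_(j < m) (fun x : 'rV[R]_m => p 0 j *: (x 0 j : R)).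
  apply/funext => y; rewrite !fctE fct_sumE /moebius_den /dot /GRing.scale /=.
  by congr (_ - _ * _); apply: eq_bigr => j _; rewrite mulrC.
apply: differentiableB => //; apply: differentiableZ.
apply: differentiable_sum => j; apply: differentiableZ.
exact: differentiable_coord.
Qed.

Lemma is_derive_moebius_den (V : normedModType R) p (Y : V -> 'rV[R]_m)
    (t v : V) dY : is_derive t v Y dY ->
  is_derive t v (fun t => moebius_den p (Y t)) (- 2 * dot dY p).
Proof.
move=> DY; have D := is_derive_dot p DY.
rewrite /moebius_den; apply: is_derive_eq.
by rewrite add0r /GRing.scale /= mulNr.
Qed.

Lemma open_moebius_den_neq0 p : open [set x | moebius_den p x != 0].
Proof.
have : continuous (moebius_den p).
  by move=> x; apply/differentiable_continuous/differentiable_moebius_den.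
move=> /continuousP /(_ [set y | y != 0]); apply.
exact: open_neq.
Qed.

Lemma near_moebius_den_neq0 p x : moebius_den p x != 0 ->
  \forall y \near x, moebius_den p y != 0.
Proof.
by move=> x0; apply: open_nbhs_nbhs; split=> //; exact: open_moebius_den_neq0.
Qed.

Lemma rational_differentiable p f x : rational_off p f ->
  moebius_den p x != 0 -> differentiable f x.
Proof.
move=> H x0; elim: H => [c|j||{}f g _ df _ dg|{}f g _ df _ dg].
- exact: differentiable_cst.
- exact: differentiable_coord.
- by apply: differentiableV => //; exact: differentiable_moebius_den.
- exact: differentiableD.
- exact: differentiableM.
Qed.

Lemma rational_derive p f v : rational_off p f -> exists2 g, rational_off p g &
  forall x, moebius_den p x != 0 -> 'D_v f x = g x.
Proof.
elim=> [c|j||{}f g rf [f' rf' df] rg [g' rg' dg]|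
  {}f g rf [f' rf' df] rg [g' rg' dg]].
- by exists (fun=> 0); [exact: rational_cst | move=> x _; exact: derive_cst].
- exists (fun=> v 0 j); first exact: rational_cst.
  move=> x _; have /is_derive_rowP /(_ j)[_ ->] := is_derive_id x v.
  by [].
- exists (fun x => 2 * dot v p * ((moebius_den p x)^-1 * (moebius_den p x)^-1)).
    apply: rational_mul; first exact: rational_cst.
    by apply: rational_mul; exact: rational_inv.
  move=> x x0; have D := is_derive_moebius_den p (is_derive_id x v).
  have [_ ->] := is_derive_inv x0 D.
  by rewrite mulNr opprK expr2 invfM.
- exists (fun x => f' x + g' x); first exact: rational_add.
  move=> x x0; rewrite -df// -dg//; apply: deriveD;
    apply: diff_derivable; exact: rational_differentiable x0.
- exists (fun x => f x * g' x + g x * f' x).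
    by apply: rational_add; apply: rational_mul.
  move=> x x0; rewrite -df// -dg//; apply: deriveM;
    apply: diff_derivable; exact: rational_differentiable x0.
Qed.

(** Each iterated derivative agrees with a map with rational coordinates on an
    open set, so it is differentiable there. *)
Lemma smooth_ball_translation p :
  smooth_on [set x | moebius_den p x != 0] (ball_translation p).
Proof.
move=> vs.
suff [G rG GE] : exists2 G : 'rV[R]_m -> 'rV[R]_m,
    forall j, rational_off p (fun x => G x 0 j) &
    forall x, moebius_den p x != 0 ->
      foldr (fun v g => 'D_v g) (ball_translation p) vs x = G x.
  move=> x x0; apply: (@near_differentiable _ _ _ G).
    near=> y; rewrite GE//; near: y.
    exact: near_moebius_den_neq0.
  by apply: differentiable_row => j; exact: rational_differentiable x0.
elim: vs => [|v vs [G rG GE]] /=.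
  exists (ball_translation p) => // j.
  rewrite (_ : (fun x => _) = (fun x => - p 0 j +
    (1 - dot p p) * (moebius_den p x)^-1 * (x 0 j + - p 0 j))); last first.
    by apply/funext => x; rewrite !mxE.
  apply: rational_add; first exact: rational_cst.
  apply: rational_mul.
    apply: rational_mul; [exact: rational_cst | exact: rational_inv].
  apply: rational_add; [exact: rational_coord | exact: rational_cst].
have /choice[h hP] j : exists g, rational_off p g /\
    forall x, moebius_den p x != 0 -> 'D_v (fun x => G x 0 j) x = g x.
  by have [g] := rational_derive v (rG j); exists g.
exists (fun x => \row_j h j x) => [j|x x0].
  under eq_fun do rewrite mxE.
  by have [] := hP j.
transitivity ('D_v G x).
  apply: near_eq_derive; near=> y; apply: GE; near: y.
  exact: near_moebius_den_neq0.
apply/rowP => j; rewrite mxE derive_mx; last first.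
  apply: diff_derivable; apply: differentiable_row => i.
  exact: rational_differentiable x0.
by rewrite mxE; have [_ ->] := hP j.
Unshelve. all: by end_near. Qed.

Lemma is_derive_ball_translation (V : normedModType R) p (Y : V -> 'rV[R]_m)
    (t v : V) dY : moebius_den p (Y t) != 0 -> is_derive t v Y dY ->
  is_derive t v (fun t => ball_translation p (Y t))
    ((1 - dot p p) *: ((moebius_den p (Y t))^-1 *: dY +
       (2 * dot dY p / moebius_den p (Y t) ^+ 2) *: (Y t - p))).
Proof.
move=> Y0 DY; have D := is_derive_moebius_den p DY.
have DI := is_derive_inv (s := fun t => moebius_den p (Y t)) Y0 D.
have Dz : is_derive t v (fun t => Y t - p) dY.
  by apply: is_derive_eq; rewrite subr0.
have DS := is_derive_scale DI Dz.
have -> : (fun t => ball_translation p (Y t)) =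
    cst (- p) + (1 - dot p p) *:
      (fun t => (moebius_den p (Y t))^-1 *: (Y t - p)).
  by apply/funext => s; rewrite !fctE /= scalerA.
apply: (is_derive_eq (is_deriveD (is_derive_cst (- p) t v)
                                 (is_deriveZ (1 - dot p p) DS))).
by rewrite add0r [X in _ *: X = _]addrC mulNr opprK.
Qed.

(** With z = x - p, the differential at a point x of the sphere sends a tangent
    vector v to the multiple by the conformal factor of v - 2 <z, v> z / |z|^2,
    the reflection of v in the hyperplane orthogonal to z. *)
Lemma conformal_ball_translation p : dot p p < 1 ->
  conformal_on_sphere (ball_translation p).
Proof.
move=> p1; exists (fun x => (1 - dot p p) / moebius_den p x) => x x1.
have D0 := moebius_den_gt0 p1 x1.
have Dx := gt_eqF D0.
split; first by rewrite divr_gt0// subr_gt0.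
have df : differentiable (ball_translation p) x.
  by apply: (smooth_ball_translation [::]); rewrite /= Dx.
have dE v : 'd (ball_translation p) x v = (1 - dot p p) *:
    ((moebius_den p x)^-1 *: v +
     (2 * dot v p / moebius_den p x ^+ 2) *: (x - p)).
  rewrite -deriveE//; have := Dx => /negbT Dn.
  by have [_ ->] := is_derive_ball_translation Dn (is_derive_id x v).
move=> v w xv xw; rewrite !dE !dotE.
rewrite !(dotC p) (dotC v x) xv xw x1 (dotC v p).
move: Dx; rewrite /moebius_den (dotC w p) => /negbT Dx.
by field.
Qed.

Lemma is_moebius_ball_translation p : dot p p < 1 ->
  is_moebius (ball_translation p).
Proof.
move=> p1.
have q1 : dot (- p) (- p) < 1 by rewrite !dotE opprK.
have sm q : dot q q < 1 -> smooth_near_sphere (ball_translation q).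
  move=> q_lt1; exists [set x | moebius_den q x != 0]; split.
  - exact: open_moebius_den_neq0.
  - by move=> x x1; rewrite /= gt_eqF// moebius_den_gt0.
  - exact: smooth_ball_translation.
split.
- split; first by move=> x; exact: ball_translation_sphere.
  + move=> x y /set_mem x1 /set_mem y1 xy.
    by rewrite -(ball_translationK p1 x1) xy ball_translationK.
  + move=> x x1; exists (ball_translation (- p) x).
      exact: ball_translation_sphere.
    by have := ball_translationK q1 x1; rewrite opprK.
- by exists (ball_translation p); split=> //;
    [exact: sm | exact: conformal_ball_translation].
- exists (ball_translation (- p)); split; first exact: sm.
  by move=> x x1; exact: ball_translationK.
Qed.

End Moebius.

(** * Mean curvature of an immersion that is conformal at a point *)

Section ConformalImmersion.
Context {R : realType} {n m : nat}.
Variables (F : 'rV[R]_n -> 'rV[R]_m) (t : 'rV[R]_n).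
Variables (dF ddF : 'I_n -> 'rV[R]_m) (mu : R).
Hypothesis n0 : (0 < n)%N.
Hypothesis mu0 : 0 < mu.
Hypothesis differentiableF : differentiable F t.
Hypothesis dFE : forall i, 'D_(delta_mx 0 i) F t = dF i.
Hypothesis ddFE : forall i, partial2 F i i t = ddF i.
Hypothesis dF_orthogonal : forall i j, dot (dF i) (dF j) = mu *+ (i == j).

Let W := \sum_i ddF i.

Lemma row_jacobian i : row i ('J F t) = dF i.
Proof. by rewrite -dFE deriveE// rowE mul_rV_lin1. Qed.

Lemma jacobianE i j : 'J F t i j = dF i 0 j.
Proof. by rewrite -row_jacobian [RHS]mxE. Qed.

Lemma conformal_first_fundamental_form : first_fundamental_form F t = mu%:M.
Proof.
apply/matrixP => i j; rewrite [LHS]mxE [RHS]mxE -dF_orthogonal.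
by apply: eq_bigr => k _; rewrite [X in _ * X]mxE !jacobianE.
Qed.

Lemma invmx_conformal_form : invmx (first_fundamental_form F t) = mu^-1%:M.
Proof. by rewrite conformal_first_fundamental_form invmx_scalar. Qed.

Lemma conformal_volume_density : volume_density F t = Num.sqrt mu ^+ n.
Proof.
rewrite /volume_density conformal_first_fundamental_form det_scalar.
rewrite -(ger0_norm (exprn_ge0 n (sqrtr_ge0 mu))) -sqrtr_sqr -exprM mulnC exprM.
by rewrite sqr_sqrtr ?ltW.
Qed.

Lemma conformal_normal_part w :
  normal_part F t w = w - mu^-1 *: \sum_k dot w (dF k) *: dF k.
Proof.
rewrite /normal_part invmx_conformal_form mul_mx_scalar -scalemxAl.
congr (_ - _ *: _); rewrite mulmx_sum_row; apply: eq_bigr => k _.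
rewrite row_jacobian; congr (_ *: _); rewrite [LHS]mxE; apply: eq_bigr => j _.
by rewrite [X in _ * X]mxE jacobianE.
Qed.

(** For the first fundamental form [mu%:M] the mean curvature only involves the
    pure second derivatives [ddF i]. *)
Lemma conformal_mean_curvature :
  mean_curvature F t = (n%:R * mu)^-1 *: normal_part F t W.
Proof.
rewrite /mean_curvature invfM -scalerA; congr (_ *: _).
transitivity (\sum_(i < n) mu^-1 *: normal_part F t (ddF i)).
  apply: eq_bigr => i _; rewrite (bigD1 i)//= big1 ?addr0 => [|j ji].
    by rewrite invmx_conformal_form mxE eqxx mulr1n /second_fundamental_form ddFE.
  by rewrite invmx_conformal_form mxE eq_sym (negbTE ji) mulr0n scale0r.
rewrite -scaler_sumr; congr (_ *: _).
by rewrite /normal_part big_split /= sumrN -!mulmx_suml.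
Qed.

(** Pythagoras: the tangential component is an orthogonal projection. *)
Lemma normal_part_sqnorm w : dot (normal_part F t w) (normal_part F t w) =
  dot w w - mu^-1 * \sum_k dot w (dF k) ^+ 2.
Proof.
rewrite conformal_normal_part; set T := \sum_k dot w (dF k) *: dF k.
have wT : dot w T = \sum_k dot w (dF k) ^+ 2.
  by rewrite dot_sumr; apply: eq_bigr => k _; rewrite dotZr expr2.
have TT : dot T T = mu * dot w T.
  rewrite {1 3}/T dot_suml dot_sumr mulr_sumr; apply: eq_bigr => k _.
  rewrite !dotZl dotZr dot_sumr (bigD1 k)//= big1 ?addr0 => [|j jk].
    by rewrite dotZr dF_orthogonal eqxx mulr1n; ring.
  by rewrite dotZr dF_orthogonal eq_sym (negbTE jk) mulr0n mulr0.
rewrite !dotE TT (dotC T) -wT.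
by field; rewrite gt_eqF.
Qed.

Lemma conformal_integrand :
  enorm (mean_curvature F t) ^+ n * volume_density F t =
  Num.sqrt ((dot W W - mu^-1 * \sum_k dot W (dF k) ^+ 2)
            / (n%:R ^+ 2 * mu)) ^+ n.
Proof.
rewrite conformal_volume_density -exprMn /enorm -sqrtrM ?dot_ge0//.
rewrite conformal_mean_curvature dotZl dotZr normal_part_sqnorm.
congr (Num.sqrt _ ^+ n); field.
by rewrite gt_eqF//= pnatr_eq0 -lt0n n0.
Qed.

End ConformalImmersion.

(** * Derivatives of the parametrization of the Clifford torus *)

Section Torus.
Context {R : realType}.

Lemma is_derive_comp_coord n (g : R -> R) dg (t v : 'rV[R]_n) k :
  is_derive (t 0 k) (1 : R) g dg ->
  is_derive t v (fun t => g (t 0 k)) (v 0 k * dg).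
Proof.
move=> [dgt dgE].
have dk := differentiable_coord t 0 k.
have dg' : differentiable g (t 0 k) by exact/derivable1_diffP.
have dc := differentiable_comp dk dg'.
split; first exact: diff_derivable.
rewrite deriveE// diff_comp// /= deriv1E// derive1E dgE.
have -> : 'd (fun N : 'rV[R]_n => N 0 k) t v = v 0 k.
  rewrite -deriveE//.
  by have /is_derive_rowP /(_ k)[_ ->] := is_derive_id t v.
by [].
Qed.

Lemma dot_mxvec n (A B : 'M[R]_(n, 2)) :
  dot (mxvec A) (mxvec B) = \sum_i (A i 0 * B i 0 + A i 1 * B i 1).
Proof.
rewrite /dot (reindex _ (curry_mxvec_bij n 2)) /=.
rewrite (eq_bigr (fun p => A p.1 p.2 * B p.1 p.2)); last first.
  by case=> i j _; rewrite !mxvecE.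
rewrite -(pair_bigA _ (fun i j => A i j * B i j)) /=.
apply: eq_bigr => i _; rewrite big_ord_recl big_ord1.
by congr (_ + A i _ * B i _); exact/val_inj.
Qed.

Definition clifford_tangent n (t : 'rV[R]_n) (i : 'I_n) : 'rV[R]_(n * 2) :=
  mxvec (\matrix_(k < n, j < 2) (if k == i then Num.sqrt n%:R^-1 *
    (if j == 0 then - sin (t 0 i) else cos (t 0 i)) else 0)).

(** The component of the point of angles [t] in the [i]-th plane; its opposite is
    the second partial derivative in the direction [i]. *)
Definition clifford_component n (t : 'rV[R]_n) (i : 'I_n) : 'rV[R]_(n * 2) :=
  mxvec (\matrix_(k < n, j < 2) (if k == i then Num.sqrt n%:R^-1 *
    (if j == 0 then cos (t 0 i) else sin (t 0 i)) else 0)).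

Lemma clifford_param_sum n (t : 'rV[R]_n) :
  clifford_param n t = \sum_i clifford_component t i.
Proof.
rewrite -linear_sum; congr mxvec; apply/matrixP => k j; rewrite summxE mxE.
rewrite (bigD1 k)//= big1 ?addr0 ?mxE ?eqxx// => i /negbTE ik.
by rewrite mxE eq_sym ik.
Qed.

Lemma is_derive_clifford_param n (t : 'rV[R]_n) i :
  is_derive t (delta_mx 0 i) (clifford_param n) (clifford_tangent t i).
Proof.
apply/is_derive_rowP => j; case/mxvec_indexP: j => k l.
rewrite mxvecE mxE; under eq_fun do rewrite mxvecE mxE.
have D : is_derive t (delta_mx 0 i)
    (fun t => if l == 0 then cos (t 0 k) else sin (t 0 k))
    ((k == i)%:R * (if l == 0 then - sin (t 0 k) else cos (t 0 k))).
  case: (l == 0).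
  - have := is_derive_comp_coord (delta_mx 0 i) (is_derive_cos (t 0 k)).
    by rewrite mxE eqxx.
  - have := is_derive_comp_coord (delta_mx 0 i) (is_derive_sin (t 0 k)).
    by rewrite mxE eqxx.
apply: is_derive_eq; rewrite /GRing.scale /=.
case: eqP => [->|_]; last by rewrite mul0r mulr0.
by rewrite mul1r.
Qed.

Lemma is_derive_clifford_tangent n (t : 'rV[R]_n) i :
  is_derive t (delta_mx 0 i) (fun t => clifford_tangent t i)
    (- clifford_component t i).
Proof.
apply/is_derive_rowP => j; case/mxvec_indexP: j => k l.
rewrite mxE mxvecE mxE; under eq_fun do rewrite mxvecE mxE.
case: (k == i); last by rewrite oppr0; exact: is_derive_cst.
have D : is_derive t (delta_mx 0 i)
    (fun t => if l == 0 then - sin (t 0 i) else cos (t 0 i))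
    (- (if l == 0 then cos (t 0 i) else sin (t 0 i))).
  have e : (delta_mx 0 i : 'rV[R]_n) 0 i = 1 by rewrite mxE !eqxx.
  case: (l == 0).
  - have := is_derive_comp_coord (delta_mx 0 i) (is_derive_sin (t 0 i)).
    by rewrite e mul1r => D; apply: is_derive_eq.
  - have := is_derive_comp_coord (delta_mx 0 i) (is_derive_cos (t 0 i)).
    by rewrite e mul1r.
apply: is_derive_eq; rewrite /GRing.scale /=.
by rewrite mulrN.
Qed.

Lemma differentiable_clifford_param n (t : 'rV[R]_n) :
  differentiable (clifford_param n) t.
Proof.
apply: differentiable_row => j; case/mxvec_indexP: j => k l.
under eq_fun do rewrite mxvecE mxE.
apply: differentiableM; first exact: differentiable_cst.
case: (l == 0).
- apply: (@differentiable_comp _ _ _ _ (fun t : 'rV[R]_n => t 0 k) (@cos R)).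
    exact: differentiable_coord.
  by apply/derivable1_diffP; exact: derivable_cos.
- apply: (@differentiable_comp _ _ _ _ (fun t : 'rV[R]_n => t 0 k) (@sin R)).
    exact: differentiable_coord.
  by apply/derivable1_diffP; exact: derivable_sin.
Qed.

Section Dots.
Variables (n : nat) (n0 : (0 < n)%N) (t : 'rV[R]_n).
Local Notation X := (clifford_param n t).
Local Notation T := (clifford_tangent t).

Lemma clifford_radius_sq : Num.sqrt (n%:R^-1 : R) ^+ 2 = n%:R^-1.
Proof. by rewrite sqr_sqrtr// invr_ge0. Qed.

Lemma clifford_param_sphere : unit_sphere X.
Proof.
rewrite /unit_sphere /= dot_mxvec (eq_bigr (fun=> n%:R^-1)) => [|i _].
  by rewrite sumr_const card_ord -[LHS]mulr_natr mulVf// pnatr_eq0 -lt0n.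
have r2 := clifford_radius_sq; have cs := cos2sin2 (t 0 i).
by rewrite !mxE /=; ring: r2 cs.
Qed.

Lemma dot_clifford_tangent_l (A : 'M[R]_(n, 2)) i : dot (T i) (mxvec A) =
  Num.sqrt n%:R^-1 * (- sin (t 0 i) * A i 0 + cos (t 0 i) * A i 1).
Proof.
rewrite dot_mxvec (bigD1 i)//= big1 ?addr0 => [|k /negbTE ki].
  by rewrite !mxE eqxx /=; ring.
by rewrite !mxE ki !mul0r addr0.
Qed.

Lemma dot_clifford_tangent_param i : dot (T i) X = 0.
Proof. by rewrite dot_clifford_tangent_l !mxE /=; ring. Qed.

Lemma dot_clifford_tangent i j : dot (T i) (T j) = n%:R^-1 *+ (i == j).
Proof.
rewrite dot_clifford_tangent_l !mxE /=; case: eqP => [->|_].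
  have r2 := clifford_radius_sq; have cs := cos2sin2 (t 0 j).
  by rewrite mulr1n; ring: r2 cs.
by rewrite !mulr0 addr0 mulr0.
Qed.

End Dots.

End Torus.

(** * Curvature of the translated torus *)

Section Translated.
Context {R : realType}.

Section Algebra.
Variables (n m : nat) (x p : 'rV[R]_m) (T Y : 'I_n -> 'rV[R]_m).
Hypothesis n0 : (0 < n)%N.
Hypothesis xx : dot x x = 1.
Hypothesis Tx : forall i, dot (T i) x = 0.
Hypothesis TT : forall i j, dot (T i) (T j) = n%:R^-1 *+ (i == j).
Hypothesis sumY : \sum_i Y i = x.
Hypothesis D0 : moebius_den p x != 0.
Hypothesis c0 : 1 - dot p p != 0.

Local Notation D := (moebius_den p x).
Local Notation c := (1 - dot p p).

(** First and second partial derivatives of the translated torus, from the point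
    [x], the tangent vectors [T i] and the plane components [Y i]. *)
Definition translated_partial i : 'rV[R]_m :=
  c *: (D^-1 *: T i + (2 * dot (T i) p / D ^+ 2) *: (x - p)).

Definition translated_partial2 i : 'rV[R]_m :=
  c *: (((4 / D ^+ 2) * dot (T i) p) *: T i - D^-1 *: Y i
    + (8 / D ^+ 3 * dot (T i) p ^+ 2 - 2 / D ^+ 2 * dot (Y i) p) *: (x - p)).

Let A := \sum_i dot (T i) p ^+ 2.

Lemma translated_partial_orthogonal i j :
  dot (translated_partial i) (translated_partial j) =
  (c ^+ 2 / (n%:R * D ^+ 2)) *+ (i == j).
Proof.
rewrite /translated_partial !dotZl !dotZr !dotDl !dotDr !dotZl !dotZr.
have -> : dot (x - p) (x - p) = D by rewrite moebius_denE.
rewrite !dotDl !dotDr !dotNl !dotNr Tx (dotC x) Tx TT (dotC p).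
case: (i == j); rewrite ?mulr1n ?mulr0n.
  by field; rewrite D0 pnatr_eq0 -lt0n n0.
by field.
Qed.

(** The torus is minimal in the sphere: the plane components add up to the
    position vector, and the sum of the second derivatives depends on [Y] only
    through [x]. *)
Lemma sum_translated_partial2 : \sum_i translated_partial2 i =
  c *: ((4 / D ^+ 2) *: (\sum_i dot (T i) p *: T i) - D^-1 *: x
        + (8 / D ^+ 3 * A - 2 / D ^+ 2 * dot x p) *: (x - p)).
Proof.
rewrite -scaler_sumr; congr (_ *: _); rewrite big_split big_split /= sumrN.
congr (_ - _ + _).
- by rewrite scaler_sumr; apply: eq_bigr => i _; rewrite scalerA.
- by rewrite -scaler_sumr sumY.
- rewrite -scaler_suml; congr (_ *: _); rewrite big_split /= sumrN.
  by rewrite -!mulr_sumr -dot_suml sumY.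
Qed.

(** This is the transformation law of the squared mean curvature, multiplied by
    the square of the conformal factor: |H|^2 = 1 for the torus itself becomes
    1 + 4 <x, p> / D - 4 |p_T|^2 / D^2, where p_T is the tangential part of p and
    n A = |p_T|^2. The remaining factor 1 / n is the first fundamental form of
    the torus. *)
Lemma translated_mean_curvature_sq
    (W := \sum_i translated_partial2 i) (mu := c ^+ 2 / (n%:R * D ^+ 2)) :
  (dot W W - mu^-1 * \sum_k dot W (translated_partial k) ^+ 2)
    / (n%:R ^+ 2 * mu) =
  n%:R^-1 * (1 + 4 * dot x p / D - 4 * n%:R * A / D ^+ 2).
Proof.
have nR : n%:R != 0 :> R by rewrite pnatr_eq0 -lt0n.
set S := \sum_i dot (T i) p *: T i.
have WE := sum_translated_partial2; rewrite -/W -/S in WE.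
have ST k : dot S (T k) = dot (T k) p / n%:R.
  rewrite dot_suml (bigD1 k)//= big1 ?addr0 => [|i ik].
    by rewrite dotZl TT eqxx.
  by rewrite dotZl TT (negbTE ik) mulr0.
have Sx : dot S x = 0.
  by rewrite dot_suml big1// => i _; rewrite dotZl Tx mulr0.
have Sp : dot S p = A.
  by rewrite dot_suml; apply: eq_bigr => i _; rewrite dotZl expr2.
have SS : dot S S = A / n%:R.
  rewrite {2}/S dot_sumr mulr_suml; apply: eq_bigr => i _.
  by rewrite dotZr ST expr2 mulrA.
have zz : dot (x - p) (x - p) = D by rewrite moebius_denE.
have xz : dot x (x - p) = 1 - dot x p by rewrite dotDr dotNr xx.
have Sz : dot S (x - p) = - A by rewrite dotDr dotNr Sx Sp add0r.
have Tz k : dot (T k) (x - p) = - dot (T k) p by rewrite dotDr dotNr Tx add0r.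
have xT k : dot x (T k) = 0 by rewrite dotC Tx.
set xi := dot x p in WE xz *.
set E := 8 / D ^+ 3 * A - 2 / D ^+ 2 * xi in WE.
(* The component of [W] along the k-th partial derivative is proportional to
   [dot (T k) p], with a factor independent of k: the sum of their squares is a
   multiple of [A]. *)
pose kappa := c ^+ 2 * ((4 / (n%:R * D ^+ 2) - E) / D
  + 2 / D ^+ 2 * (- (4 / D ^+ 2) * A - (1 - xi) / D + E * D)).
have WF k : dot W (translated_partial k) = dot (T k) p * kappa.
  rewrite WE /translated_partial !dotZl !dotZr !dotDl !dotDr !dotZl !dotZr.
  rewrite !dotNl !dotZl zz xz Sz ST xT (dotC (x - p)) Tz /kappa.
  by field; rewrite D0 nR.
have -> : \sum_k dot W (translated_partial k) ^+ 2 = A * kappa ^+ 2.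
  by rewrite mulr_suml; apply: eq_bigr => k _; rewrite WF exprMn.
have -> : dot W W = c ^+ 2 * (16 / D ^+ 4 * (A / n%:R) + 1 / D ^+ 2 + E ^+ 2 * D
    - 8 / D ^+ 2 * E * A - 2 / D * E * (1 - xi)).
  rewrite WE !dotZl !dotZr !dotDl !dotDr !dotNl !dotNr !dotZl !dotZr.
  rewrite zz !(dotC (x - p)) xz Sz (dotC x S) Sx SS xx.
  by field; rewrite D0 nR.
by rewrite /mu /kappa /E; field; rewrite D0 c0 nR.
Qed.

End Algebra.

Section Curvature.
Variables (n : nat) (n0 : (0 < n)%N) (p : 'rV[R]_(n * 2)) (p1 : dot p p < 1).
Local Notation X := (@clifford_param R n).

Lemma clifford_den_neq0 t : moebius_den p (X t) != 0.
Proof. by rewrite gt_eqF// moebius_den_gt0//; exact: clifford_param_sphere. Qed.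

Lemma derive_translated_clifford i t :
  'D_(delta_mx 0 i) (ball_translation p \o X) t =
  translated_partial (X t) p (clifford_tangent t) i.
Proof.
have D := is_derive_clifford_param t i.
by have [_ ->] := is_derive_ball_translation (clifford_den_neq0 t) D.
Qed.

Lemma partial2_translated_clifford i t :
  partial2 (ball_translation p \o X) i i t =
  translated_partial2 (X t) p (clifford_tangent t) (clifford_component t) i.
Proof.
rewrite /partial2.
rewrite (_ : 'D_(delta_mx 0 i) (ball_translation p \o X) = fun t =>
  translated_partial (X t) p (clifford_tangent t) i); last first.
  by apply/funext => s; exact: derive_translated_clifford.
have DX := is_derive_clifford_param t i.
have DT := is_derive_clifford_tangent t i.
have D0 := clifford_den_neq0 t.
have DD := is_derive_moebius_den p DX.
have DI := is_derive_inv (s := fun t => moebius_den p (X t)) D0 DD.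
have Da := is_derive_dot p DT.
have Dz : is_derive t (delta_mx 0 i) (fun t => X t - p) (clifford_tangent t i).
  by apply: is_derive_eq; rewrite subr0.
have DI2 := is_deriveM (is_deriveM DI DI) Da.
have D1 := is_derive_scale DI DT.
have D2 := is_derive_scale DI2 Dz.
have H := is_deriveZ (1 - dot p p) (is_deriveD D1 (is_deriveZ 2 D2)).
rewrite (_ : (fun t => translated_partial _ _ _ _) =
  (1 - dot p p) *: ((fun t => (moebius_den p (X t))^-1 *: clifford_tangent t i)
   + 2 *: (fun t => ((fun t => (moebius_den p (X t))^-1)
       * (fun t => (moebius_den p (X t))^-1)
       * (fun t => dot (clifford_tangent t i) p)) t *: (X t - p)))); last first.
  apply/funext => s; rewrite !fctE /translated_partial /= !scalerA.
  congr (_ *: (_ + _ *: _)).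
  by rewrite invfM !mulrA mulrAC -!mulrA; congr (_ * _); ring.
have [_ ->] := H.
rewrite /translated_partial2 !fctE dotNl; congr (_ *: _).
move: (moebius_den p (X t)) D0 (clifford_tangent t i) (X t - p) => d d0 u z.
move: (clifford_component t i) => w.
by apply/rowP => j; rewrite !mxE /GRing.scale /=; field.
Qed.

Lemma translated_clifford_integrand t :
  let D := moebius_den p (X t) in
  let F := ball_translation p \o X in
  enorm (mean_curvature F t) ^+ n * volume_density F t =
  Num.sqrt (n%:R^-1 * (1 + 4 * dot (X t) p / D -
    4 * n%:R * (\sum_i dot (clifford_tangent t i) p ^+ 2) / D ^+ 2)) ^+ n.
Proof.
move=> D F.
have D0 := clifford_den_neq0 t.
have c0 : 1 - dot p p != 0 by rewrite subr_eq0 gt_eqF.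
have Tx i := dot_clifford_tangent_param t i.
have TT i j := dot_clifford_tangent t i j.
have xx := clifford_param_sphere n0 t.
have dF : differentiable F t.
  apply: differentiable_comp; first exact: differentiable_clifford_param.
  exact: (smooth_ball_translation [::]).
have mu0 : 0 < (1 - dot p p) ^+ 2 / (n%:R * D ^+ 2) :> R.
  have D1 : 0 < D by exact: moebius_den_gt0.
  have c1 : 0 < 1 - dot p p by rewrite subr_gt0.
  by apply: divr_gt0; rewrite ?mulr_gt0 ?exprn_gt0// ltr0n.
rewrite (conformal_integrand n0 mu0 dF
  (fun i => derive_translated_clifford i t)
  (fun i => partial2_translated_clifford i t)
  (translated_partial_orthogonal n0 xx Tx TT D0)).
rewrite translated_mean_curvature_sq//.
by rewrite -clifford_param_sum.
Qed.

End Curvature.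

Section Direction.
Variables (n : nat) (n0 : (0 < n)%N) (b : R).
Hypothesis b1 : b ^+ 2 < 1.

(** The center p of the overview, of norm [`|b|] and with equal components along
    the first axes of the planes. The sign makes the denominator of
    [ball_translation] a positive multiple of 1 + r l. *)
Definition torus_direction : 'rV[R]_(n * 2) :=
  mxvec (\matrix_(k < n, j < 2)
    (if j == 0 then - (b * Num.sqrt n%:R^-1) else 0)).

Lemma dot_torus_direction : dot torus_direction torus_direction = b ^+ 2.
Proof.
rewrite dot_mxvec (eq_bigr (fun=> b ^+ 2 / n%:R)) => [|i _].
  by rewrite sumr_const card_ord -[LHS]mulr_natr divfK// pnatr_eq0 -lt0n.
rewrite !mxE /= mulr0 addr0 mulrNN; have r2 := clifford_radius_sq (R := R) n.
by ring: r2.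
Qed.

Lemma dot_clifford_direction t :
  dot (clifford_param n t) torus_direction = - (b / n%:R * cos_sum t).
Proof.
rewrite dot_mxvec /cos_sum mulr_sumr -sumrN; apply: eq_bigr => i _.
rewrite !mxE /= mulr0 addr0; have r2 := clifford_radius_sq (R := R) n.
by ring: r2.
Qed.

Lemma dot_clifford_tangent_direction (t : 'rV[R]_n) i :
  dot (clifford_tangent t i) torus_direction = b / n%:R * sin (t 0 i).
Proof.
rewrite dot_clifford_tangent_l !mxE /= mulr0 addr0.
have r2 := clifford_radius_sq (R := R) n.
by ring: r2.
Qed.

Lemma sum_dot_clifford_tangent_direction (t : 'rV[R]_n) :
  \sum_i dot (clifford_tangent t i) torus_direction ^+ 2 =
  (b / n%:R) ^+ 2 * (n%:R - cos2_sum t).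
Proof.
have -> : n%:R - cos2_sum t = \sum_i sin (t 0 i) ^+ 2.
  rewrite -[n in n%:R]card_ord -sumr_const -sumrB.
  by apply: eq_bigr => i _; rewrite sin2cos2.
rewrite mulr_sumr; apply: eq_bigr => i _.
by rewrite dot_clifford_tangent_direction exprMn.
Qed.

Lemma torus_direction_integrand t
    (r := 2 * b / (1 + b ^+ 2)) (l := cos_sum t / n%:R)
    (F := ball_translation torus_direction \o clifford_param n) :
  enorm (mean_curvature F t) ^+ n * volume_density F t =
  Num.sqrt n%:R^-1 ^+ n *
  (Num.sqrt (1 - r ^+ 2 * (l ^+ 2 + 1 - cos2_sum t / n%:R)) / (1 + r * l)) ^+ n.
Proof.
have p1 : dot torus_direction torus_direction < 1.
  by rewrite dot_torus_direction.
rewrite (translated_clifford_integrand n0 p1) -exprMn; congr (_ ^+ _).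
have B0 : 0 < 1 + b ^+ 2 by rewrite ltr_wpDr ?sqr_ge0.
have nR : n%:R != 0 :> R by rewrite pnatr_eq0 -lt0n.
have DE : moebius_den torus_direction (clifford_param n t) =
    (1 + b ^+ 2) * (1 + r * l).
  rewrite /moebius_den dot_torus_direction dot_clifford_direction /r /l.
  by field; rewrite nR gt_eqF.
have D0 := moebius_den_gt0 p1 (clifford_param_sphere n0 t).
have rl0 : 0 < 1 + r * l by move: D0; rewrite DE pmulr_rgt0.
rewrite sqrtrM ?invr_ge0//; congr (_ * _).
have -> : (1 + r * l)^-1 = Num.sqrt ((1 + r * l) ^- 2).
  by rewrite sqrtrV ?sqr_ge0// sqrtr_sqr ger0_norm// ltW.
rewrite [RHS]mulrC -sqrtrM ?invr_ge0 ?sqr_ge0//; congr Num.sqrt.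
rewrite DE dot_clifford_direction sum_dot_clifford_tangent_direction.
have -> : cos_sum t = l * n%:R by rewrite divfK.
have rl1 : 1 + b ^+ 2 + 2 * b * l != 0.
  rewrite (_ : _ + _ = (1 + b ^+ 2) * (1 + r * l)).
    by rewrite mulf_neq0 ?gt_eqF.
  by rewrite /r; field; rewrite gt_eqF.
by rewrite /r; field; rewrite nR rl1 gt_eqF.
Qed.
End Direction.

End Translated.

(** * Comparison of the total mean curvatures *)

Section Comparison.
Context {R : realType}.

(** The averages of the terms of order 1, 2 and 3 in r vanish, and the one of
    order 4 is - (n - 1) (n - 2) / (32 n). *)
Lemma translated_total_le n : (0 < n)%N -> exists2 C : R, 0 <= C &
  forall b : R, 0 <= b <= 1 / 4 -> let r := 2 * b / (1 + b ^+ 2) in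
  (total_mean_curvature (ball_translation (torus_direction n b) \o
     clifford_param n) <=
   ((2 * pi) ^+ n * Num.sqrt n%:R^-1 ^+ n *
    (1 - (n%:R - 1) * (n%:R - 2) / (32 * n%:R) * r ^+ 4 + C * r ^+ 5))%:E)%E.
Proof.
move=> n0; have [C C0 HC] := integrand_taylor4 (R := R) n.
exists C; first by [].
move=> b /andP[b0 b4]; set r := 2 * b / (1 + b ^+ 2); cbv zeta.
have nR : n%:R != 0 :> R by rewrite pnatr_eq0 -lt0n.
have np : 0 < n%:R :> R by rewrite ltr0n.
have b1 : b ^+ 2 < 1 by rewrite expr2; nra.
have B1 : 1 <= 1 + b ^+ 2 by rewrite lerDl sqr_ge0.
have B0 : 0 < 1 + b ^+ 2 by lra.
have r0 : 0 <= r by rewrite divr_ge0 ?mulr_ge0// ltW.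
have r2 : r <= 1 / 2 by rewrite ler_pdivrMr//; lra.
pose K : R := Num.sqrt n%:R^-1 ^+ n.
have K0 : 0 <= K by rewrite exprn_ge0// sqrtr_ge0.
pose N : R := n%:R.
(* Coefficients of the expansion in the power sums [S] and [P], after the
   substitution l = S / n, q = l^2 + 1 - P / n. *)
pose c0 := 1 - N / 2 * r ^+ 2 + N * (N - 2) / 8 * r ^+ 4 + C * r ^+ 5.
pose c1 := - r + N / 2 * r ^+ 3.
pose c2 := r ^+ 2 / 2 + (- (N + 1) / 4 + (N - 2) / (4 * N)) * r ^+ 4.
pose c3 := (N ^+ 2 / 2 - N * (N + 1) * (N + 2) / 6) / N ^+ 3 * r ^+ 3.
pose c4 := (N * (N + 1) * (N + 2) * (N + 3) / 24 - N ^+ 2 * (N + 1) / 4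
  + N * (N - 2) / 8) / N ^+ 4 * r ^+ 4.
pose d0 := r ^+ 2 / 2 - (N - 2) / 4 * r ^+ 4.
pose d1 := - r ^+ 3 / 2.
pose d2 := (N ^+ 2 * (N + 1) / 4 - N * (N - 2) / 4) / N ^+ 3 * r ^+ 4.
pose e := (N - 2) / (8 * N) * r ^+ 4.
have S1 (t : 'rV[R]_n) : `|cos_sum t / n%:R| <= 1.
  rewrite normrM normfV (ger0_norm (ler0n _ _)) ler_pdivrMr// mul1r.
  apply: le_trans (ler_norm_sum _ _ _) _.
  rewrite -[n in n%:R]card_ord -sumr_const; apply: ler_sum => i _.
  by rewrite ler_norml cos_geN1 cos_le1.
have q01 (t : 'rV[R]_n) :
    0 <= (cos_sum t / n%:R) ^+ 2 + 1 - cos2_sum t / n%:R <= 1.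
  apply/andP; split.
    rewrite -addrA addr_ge0 ?sqr_ge0// subr_ge0 ler_pdivrMr// mul1r.
    rewrite -[n in n%:R]card_ord -sumr_const; apply: ler_sum => i _.
    by rewrite -(cos2Dsin2 (t 0 i)) lerDl sqr_ge0.
  (* The upper bound is Cauchy-Schwarz, as the nonnegativity of a variance. *)
  set l := cos_sum t / n%:R.
  have V : \sum_i (cos (t 0 i) - l) ^+ 2 = cos2_sum t - n%:R * l ^+ 2.
    transitivity (\sum_i (cos (t 0 i) ^+ 2 + (- 2 * l * cos (t 0 i) + l ^+ 2))).
      by apply: eq_bigr => i _; ring.
    rewrite !big_split /= -mulr_sumr sumr_const card_ord -/(cos_sum t).
    rewrite -[_ *+ n]mulr_natr.
    have -> : cos_sum t = l * n%:R by rewrite divfK.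
    by rewrite /cos2_sum; ring.
  have V0 : 0 <= cos2_sum t - n%:R * l ^+ 2.
    by rewrite -V sumr_ge0// => i _; exact: sqr_ge0.
  have : l ^+ 2 <= cos2_sum t / n%:R by rewrite ler_pdivlMr//; lra.
  lra.
rewrite /total_mean_curvature.
apply: (@le_trans _ _ (cube_integral angles (fun t : 'rV[R]_n =>
    let S := cos_sum t in let P := cos2_sum t in
    (K * c0 + K * c1 * S + K * c2 * S ^+ 2 + K * c3 * S ^+ 3 + K * c4 * S ^+ 4
     + K * d0 * P + K * d1 * (S * P) + K * d2 * (S ^+ 2 * P)
     + K * e * P ^+ 2)%:E))).
  apply: le_cube_integral => t.
    by rewrite lee_fin mulr_ge0// ?exprn_ge0 ?sqrtr_ge0.
  rewrite (torus_direction_integrand n0 b1) lee_fin -/r -/K.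
  have r02 : 0 <= r <= 1 / 2 by rewrite r0.
  apply: le_trans (ler_wpM2l K0 (HC r _ _ r02 (S1 t) (q01 t))) _.
  rewrite le_eqVlt; apply/orP; left; apply/eqP.
  by rewrite /c0 /c1 /c2 /c3 /c4 /d0 /d1 /d2 /e /N; field.
rewrite cube_integral_quartic lee_fin -/K.
rewrite le_eqVlt; apply/orP; left; apply/eqP.
by rewrite /c0 /c2 /c4 /d0 /d2 /e /N; field.
Qed.

Lemma ball_translation0 m : ball_translation (0 : 'rV[R]_m) = id.
Proof.
apply/funext => x; rewrite /ball_translation /moebius_den (dotC x) !dot0l.
by rewrite !(oppr0, mulr0, addr0, add0r, divr1, scale1r).
Qed.

Lemma torus_direction0 n : torus_direction n (0 : R) = 0.
Proof.
rewrite /torus_direction -[RHS](linear0 mxvec); congr mxvec.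
by apply/matrixP => i j; rewrite !mxE mul0r oppr0; case: ifP.
Qed.

Lemma clifford_total n : (0 < n)%N ->
  total_mean_curvature (@clifford_param R n) =
  ((2 * pi) ^+ n * Num.sqrt n%:R^-1 ^+ n)%:E.
Proof.
move=> n0.
have b1 : (0 : R) ^+ 2 < 1 by rewrite expr0n.
have H := torus_direction_integrand n0 b1.
rewrite torus_direction0 ball_translation0 in H.
have {}H (t : 'rV[R]_n) : enorm (mean_curvature (clifford_param n) t) ^+ n *
    volume_density (clifford_param n) t = Num.sqrt n%:R^-1 ^+ n.
  apply: (etrans (H t)).
  rewrite mulr0 !mul0r expr0n /= mul0r subr0 addr0 sqrtr1 divr1 expr1n.
  by rewrite mulr1.
rewrite /total_mean_curvature.
transitivity (cube_integral angles (fun t : 'rV[R]_n =>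
    let S := cos_sum t in let P := cos2_sum t in
    (Num.sqrt n%:R^-1 ^+ n + 0 * S + 0 * S ^+ 2 + 0 * S ^+ 3 + 0 * S ^+ 4
     + 0 * P + 0 * (S * P) + 0 * (S ^+ 2 * P) + 0 * P ^+ 2)%:E)).
  congr cube_integral; apply/funext => t.
  by rewrite H /= !(mul0r, addr0).
by rewrite cube_integral_quartic; congr EFin; ring.
Qed.

End Comparison.

Theorem corollary5p3 (R : realType) (n : nat) (n_ge3 : (3 <= n)%N) :
  exists Phi : 'rV[R]_(n * 2) -> 'rV[R]_(n * 2),
    is_moebius Phi /\
    (total_mean_curvature (Phi \o clifford_param n) <
     total_mean_curvature (@clifford_param R n))%E.
Proof.
have n0 : (0 < n)%N by exact: leq_trans n_ge3.
have [C C0 HC] := translated_total_le (R := R) n0.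
have N3 : 3 <= n%:R :> R by rewrite ler_nat.
pose k : R := (n%:R - 1) * (n%:R - 2) / (32 * n%:R).
have k0 : 0 < k by rewrite divr_gt0// ?mulr_gt0//; lra.
(* The parameter r = 2 b / (1 + b^2) is below 2 b; this b makes C r < k. *)
pose b := k / (4 * (k + C + 1)).
have kC : 0 < 4 * (k + C + 1) by lra.
have b0 : 0 < b by rewrite divr_gt0.
have b4 : b <= 1 / 4 by rewrite ler_pdivrMr//; lra.
have bC : 2 * b * C < k.
  rewrite /b mulrAC mulrA ltr_pdivrMr//.
  nra.
have bb : 0 <= b <= 1 / 4 by rewrite ltW.
have b1 : b ^+ 2 < 1 by rewrite expr2; nra.
exists (ball_translation (torus_direction n b)); split.
  by apply: is_moebius_ball_translation; rewrite dot_torus_direction.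
apply: le_lt_trans (HC b bb) _.
rewrite clifford_total// lte_fin -/k.
set r := 2 * b / _.
have B1 : 1 <= 1 + b ^+ 2 by rewrite lerDl sqr_ge0.
have B0 : 0 < 1 + b ^+ 2 by lra.
have b20 : 0 < 2 * b by lra.
have r0 : 0 < r by rewrite /r divr_gt0.
have rb : r <= 2 * b by rewrite /r ler_pdivrMr// ler_peMr// ltW.
have rC : C * r < k by nra.
rewrite gtr_pMr; last first.
  by rewrite mulr_gt0// exprn_gt0// ?mulr_gt0 ?pi_gt0// sqrtr_gt0 invr_gt0 ltr0n.
have r4 : 0 < r ^+ 4 by rewrite exprn_gt0.
have -> : C * r ^+ 5 = C * r * r ^+ 4 by ring.
nra.
Qed.
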